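(* Let $\mathbf L$ be an $\mathrm e$-cyclic residuated lattice and let $S\subseteq L$. Then $$\mathrm C[S]=\mathrm C[|S|]=\{x\in L: h\le x\le h\backslash \mathrm e \text{ for some } h\in\langle |S|\rangle\}=\{x\in L: h\le |x| \text{ for some } h\in\langle |S|\rangle\}.$$
   Context: A residuated lattice is an algebra $\mathbf L=(L,\cdot,\backslash,/,\vee,\wedge,\mathrm e)$ such that $(L,\cdot,\mathrm e)$ is a monoid, $(L,\vee,\wedge)$ is a lattice with order $\le$, and $x\cdot y\le z \iff y\le x\backslash z \iff x\le z/y$ for all $x,y,z\in L$. It is $\mathrm e$-cyclic if $\mathrm e/x=x\backslash \mathrm e$ for all $x\in L$. A convex subalgebra of $\mathbf L$ is a subalgebra (closed under all operations, containing $\mathrm e$) whose universe is order-convex. For $S\subseteq L$, $\mathrm C[S]$ is the smallest convex subalgebra containing $S$. The absolute value of $x\in L$ is $|x|=x\wedge(\mathrm e/x)\wedge \mathrm e$, and $|S|=\{|s|:s\in S\}$. For $T\subseteq L$, $\langle T\rangle$ denotes the submonoid of $(L,\cdot,\mathrm e)$ generated by $T$. *)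

(* Defs.v *)
From HB Require Import structures.
From mathcomp Require Import all_boot all_order.
From mathcomp Require Import classical_sets.

Set Implicit Arguments.
Unset Strict Implicit.
Unset Printing Implicit Defensive.

Local Open Scope classical_set_scope.
Local Open Scope group_scope.
Local Open Scope order_scope.

(* [ldiv x z] is x \ z and [rdiv z y] is z / y.  The division [_ / _] of
   [group_scope] is multiplication by an inverse and is not used here. *)
HB.mixin Record Monoid_Lattice_isResiduated (d : Order.disp_t) L
    of monoid.Monoid L & Order.Lattice d L := {
  ldiv : L -> L -> L;
  rdiv : L -> L -> L;
  le_ldiv : forall x y z : L, (x * y <= z) = (y <= ldiv x z);
  le_rdiv : forall x y z : L, (x * y <= z) = (x <= rdiv z y)
}.

#[short(type="residuatedLatticeType")]
HB.structure Definition ResiduatedLattice (d : Order.disp_t) :=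
  { L of monoid.Monoid L & Order.Lattice d L
       & Monoid_Lattice_isResiduated d L }.

Section ResiduatedLatticeDefs.
Variables (d : Order.disp_t) (L : residuatedLatticeType d).
Implicit Types (x y z : L) (A S T : set L).

Definition e_cyclic := forall x, rdiv 1 x = ldiv x 1.

Definition absval x : L := x `&` rdiv 1 x `&` 1.

Definition is_submonoid A := A 1 /\ forall x y, A x -> A y -> A (x * y).

Definition gen_submonoid T : set L := smallest is_submonoid T.

Definition is_subalgebra A :=
  is_submonoid A /\
  forall x y, A x -> A y ->
    [/\ A (ldiv x y), A (rdiv x y), A (x `|` y) & A (x `&` y)].

Definition order_convex A :=
  forall x y z, A x -> A z -> x <= y -> y <= z -> A y.

Definition is_convex_subalgebra A := is_subalgebra A /\ order_convex A.

Definition convex_subalgebra S : set L := smallest is_convex_subalgebra S.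

Lemma gen_submonoidP T : is_submonoid (gen_submonoid T).
Proof.
split=> [A [[]] //|x y Tx Ty A [Am TA]].
by apply: Am.2; [apply: Tx|apply: Ty].
Qed.

Lemma convex_subalgebraP S : is_convex_subalgebra (convex_subalgebra S).
Proof.
split; last first.
  move=> x y z Sx Sz xy yz A AS.
  by case: (AS) => -[_ cA] _; apply: (cA _ _ _ (Sx _ AS) (Sz _ AS)).
split; first split=> [A [[[[]]]] //|x y Sx Sy A AS].
  by case: (AS) => -[[Am _] _] _; apply: Am.2; [apply: Sx|apply: Sy].
move=> x y Sx Sy; split=> A AS; case: (AS) => -[[_ sA] _] _;
  by case: (sA x y (Sx _ AS) (Sy _ AS)).
Qed.

End ResiduatedLatticeDefs.

Arguments e_cyclic {d} L.

(* Main.v *)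
(* For a submonoid H of elements below the unit e, the elements x with
   h <= x <= h \ e for some h in H form a convex subalgebra: multiplying
   elements of H only goes down, so lower and upper bounds may be sought with
   different witnesses, and e-cyclicity gives h (h \ e) <= e and
   (h \ e) h <= e, which bounds each operation.  For H generated by |S| this
   subalgebra contains |S|, and it lies in every convex subalgebra containing
   |S|.  Finally h <= |x| unfolds to h <= x <= h \ e, and taking h = |s| puts
   each s between elements of C[|S|]. *)
Require Import Defs.
From mathcomp Require Import all_boot all_order.
From mathcomp Require Import classical_sets.

Set Implicit Arguments.
Unset Strict Implicit.
Unset Printing Implicit Defensive.

Local Open Scope classical_set_scope.
Local Open Scope group_scope.
Local Open Scope order_scope.

Import Order.Theory.

Section ResiduatedLatticeTheory.
Variables (d : Order.disp_t) (L : residuatedLatticeType d).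
Implicit Types (x y z h k : L) (S T A H : set L).

Lemma ler_mul x x' y y' : x <= x' -> y <= y' -> x * y <= x' * y'.
Proof.
move=> xx' yy'; apply: (@le_trans _ _ (x' * y)).
  by rewrite le_rdiv (le_trans xx') // -le_rdiv.
by rewrite le_ldiv (le_trans yy') // -le_ldiv.
Qed.

Lemma mul_ldiv_le x z : x * ldiv x z <= z.
Proof. by rewrite le_ldiv. Qed.

Lemma rdiv_mul_le x z : rdiv z x * x <= z.
Proof. by rewrite le_rdiv. Qed.

Lemma mul_le_l x y : y <= 1 -> x * y <= x.
Proof. by move=> y1; rewrite -[leRHS]mulg1 ler_mul. Qed.

Lemma mul_le_r x y : x <= 1 -> x * y <= y.
Proof. by move=> x1; rewrite -[leRHS]mul1g ler_mul. Qed.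

Lemma absval_le x : absval x <= x.
Proof. by rewrite /absval -meetA leIl. Qed.

Lemma absval_le1 x : absval x <= 1.
Proof. exact: leIr. Qed.

(** By residuation, [h <= rdiv 1 x] and [x <= ldiv h 1] both say [h * x <= 1]. *)
Lemma le_absval h x :
  (h <= absval x) = [&& h <= x, x <= ldiv h 1 & h <= 1].
Proof. by rewrite /absval !lexI -le_rdiv le_ldiv andbA. Qed.

Lemma le_ldiv_absval x : x <= ldiv (absval x) 1.
Proof. by have := lexx (absval x); rewrite le_absval => /and3P[]. Qed.

Lemma gen_submonoid_sub T A :
  is_submonoid A -> T `<=` A -> gen_submonoid T `<=` A.
Proof. by move=> Am TA x; apply. Qed.

Lemma gen_submonoid_le1 T h :
  (forall x, T x -> x <= 1) -> gen_submonoid T h -> h <= 1.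
Proof.
move=> T1; apply: (@gen_submonoid_sub T [set x | x <= 1]) => //.
by split=> [|x y x1 y1] /=; [exact: lexx|rewrite -[1]mulg1 ler_mul].
Qed.

(** [H] is an arbitrary set, since it will be a generated submonoid but also a whole convex
    subalgebra. *)
Definition bounded_by H : set L :=
  [set x | exists2 h, H h & h <= x /\ x <= ldiv h 1].

Section BoundedBy.
Hypothesis hL : e_cyclic L.
Variable H : set L.
Hypotheses (Hm : is_submonoid H) (H1 : forall h, H h -> h <= 1).

Let ldiv_mul_le1 h : ldiv h 1 * h <= 1.
Proof. by rewrite -hL rdiv_mul_le. Qed.

(** The common witness is [h * k]: it lies below [h], and [(h * k) * x <= k * x <= 1]. *)
Lemma bounded_by_intro h k x :
  H h -> H k -> h <= x -> x <= ldiv k 1 -> bounded_by H x.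
Proof.
move=> Hh Hk hx xk; exists (h * k); first exact: Hm.2.
split; first by apply: le_trans hx; apply/mul_le_l/H1.
rewrite -le_ldiv; apply: le_trans (mul_ldiv_le k 1).
by apply: ler_mul xk; apply/mul_le_r/H1.
Qed.

Lemma bounded_by_sub : H `<=` bounded_by H.
Proof.
move=> h Hh; exists h => //; split=> //; rewrite -le_ldiv.
by apply: le_trans (H1 Hh); apply/mul_le_l/H1.
Qed.

Lemma bounded_by_convex_subalgebra : is_convex_subalgebra (bounded_by H).
Proof.
have H2 : forall h k, H h -> H k -> H (h * k) by exact: Hm.2.
split; last first.
  move=> x y z [h Hh [hx _]] [k Hk [_ zk]] xy yz.
  exact: bounded_by_intro Hh Hk (le_trans hx xy) (le_trans yz zk).
split; first split; first exact/bounded_by_sub/Hm.1.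
  move=> x y [h Hh [hx xh]] [k Hk [ky yk]].
  (* The upper witness reverses the factors, so that [h] meets [x] first:
     [k * ((h * x) * y) <= k * y <= 1]. *)
  apply: (bounded_by_intro (H2 _ _ Hh Hk) (H2 _ _ Hk Hh)).
    exact: ler_mul.
  rewrite -le_ldiv -mulgA (mulgA h).
  apply: le_trans (mul_ldiv_le k 1); apply: ler_mul => //.
  apply: le_trans yk; apply: mul_le_r.
  by rewrite le_ldiv.
move=> x y [h Hh [hx xh]] [k Hk [ky yk]].
have hkh : h * k <= h by apply/mul_le_l/H1.
have hkk : h * k <= k by apply/mul_le_r/H1.
split.
(* Left division: [(x * h) * k <= k <= y], where [x * h <= 1] uses e-cyclicity; above,
   [k * (h * ldiv x y) <= k * y <= 1]. *)
- apply: (bounded_by_intro (H2 _ _ Hh Hk) (H2 _ _ Hk Hh)).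
    rewrite -le_ldiv mulgA; apply: le_trans ky; apply: mul_le_r.
    exact: le_trans (ler_mul xh (lexx h)) (ldiv_mul_le1 h).
  rewrite -le_ldiv -mulgA; apply: le_trans (mul_ldiv_le k 1).
  apply: ler_mul => //; apply: le_trans yk.
  exact: le_trans (ler_mul hx (lexx _)) (mul_ldiv_le x y).
- apply: (bounded_by_intro (H2 _ _ Hh Hk) (H2 _ _ Hk Hh)).
    rewrite -le_rdiv -mulgA; apply: le_trans hx; apply: mul_le_l.
    by rewrite le_ldiv.
  (* E-cyclicity moves [k * h] to the right of [rdiv x y], where [k <= y] cancels the division and
     leaves [x * h <= 1]. *)
  rewrite -hL -le_rdiv mulgA; apply: le_trans (ldiv_mul_le1 h).
  apply: ler_mul => //; apply: le_trans xh.
  exact: le_trans (ler_mul (lexx _) ky) (rdiv_mul_le y x).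
(* A join is above [h] already, but its upper bound must serve both [x] and [y], hence [h * k]; the
   meet is dual. *)
- apply: (bounded_by_intro Hh (H2 _ _ Hh Hk)); first by rewrite lexU2 ?hx.
  rewrite leUx -!le_ldiv; apply/andP; split.
    exact: le_trans (ler_mul hkh xh) (mul_ldiv_le h 1).
  exact: le_trans (ler_mul hkk yk) (mul_ldiv_le k 1).
- apply: (bounded_by_intro (H2 _ _ Hh Hk) Hh); last by rewrite leIx2 ?xh.
  by rewrite lexI (le_trans hkh) ?(le_trans hkk).
Qed.

End BoundedBy.

Lemma convex_subalgebra_min S A :
  is_convex_subalgebra A -> S `<=` A -> convex_subalgebra S `<=` A.
Proof. by move=> Ac SA x; apply. Qed.

Lemma sub_convex_subalgebra S : S `<=` convex_subalgebra S.
Proof. by move=> x Sx A [_]; apply. Qed.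

(** Closure under division puts [ldiv h 1] in [A], so convexity captures everything between [h] and
    it. *)
Lemma convex_subalgebra_bounded_by A H :
  is_convex_subalgebra A -> H `<=` A -> bounded_by H `<=` A.
Proof.
move=> [[[A1 _] Aop] Ac] HA x [h /HA Ah [hx xh]].
by apply: Ac hx xh => //; case: (Aop h 1).
Qed.

Lemma absval_bounded_by x A : A (absval x) -> bounded_by A x.
Proof.
by exists (absval x) => //; split; [exact: absval_le|exact: le_ldiv_absval].
Qed.

Lemma convex_subalgebra_absval S :
  convex_subalgebra S = convex_subalgebra (@absval d L @` S).
Proof.
apply/seteqP; split; apply: convex_subalgebra_min;
  try exact: convex_subalgebraP.
  move=> s Ss; apply: (convex_subalgebra_bounded_by (convex_subalgebraP _)
    (@subset_refl _ _)).
  by apply: absval_bounded_by; apply: sub_convex_subalgebra; exists s.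
(* Conversely, [absval s] is a term in [s] and [1], built here one operation at a time. *)
move=> _ [s Ss <-]; have [[[C1 _] Cop] _] := convex_subalgebraP S.
have Cs := sub_convex_subalgebra Ss.
have [_ Cd _ _] := Cop 1 s C1 Cs.
have [_ _ _ Ci] := Cop _ _ Cs Cd.
by have [] := Cop _ _ Ci C1.
Qed.

Lemma convex_subalgebra_bounded S :
  e_cyclic L -> (forall x, S x -> x <= 1) ->
  convex_subalgebra S = bounded_by (gen_submonoid S).
Proof.
move=> hL S1; have Hm := gen_submonoidP S.
have H1 h (Hh : gen_submonoid S h) := gen_submonoid_le1 S1 Hh.
apply/seteqP; split.
  apply: convex_subalgebra_min; first exact: bounded_by_convex_subalgebra.
  by move=> x Sx; apply: bounded_by_sub => // A [_]; apply.
have Cc := convex_subalgebraP S.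
apply: convex_subalgebra_bounded_by => //.
by apply: gen_submonoid_sub Cc.1.1 _; exact: sub_convex_subalgebra.
Qed.

End ResiduatedLatticeTheory.

Theorem lemma3p2 (d : Order.disp_t) (L : residuatedLatticeType d)
    (hL : e_cyclic L) (S : set L) :
  [/\ convex_subalgebra S = convex_subalgebra (@absval d L @` S),
      convex_subalgebra (@absval d L @` S) =
        [set x : L | exists2 h : L, gen_submonoid (@absval d L @` S) h
                                  & h <= x /\ x <= ldiv h 1]
    & [set x : L | exists2 h : L, gen_submonoid (@absval d L @` S) h
                                & h <= x /\ x <= ldiv h 1] =
        [set x : L | exists2 h : L, gen_submonoid (@absval d L @` S) h
                                  & h <= absval x]].
Proof.
have S1 x : (@absval d L @` S) x -> x <= 1.
  by case=> s _ <-; exact: absval_le1.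
split; [exact: convex_subalgebra_absval|exact: convex_subalgebra_bounded|].
apply/seteqP; split=> x [h Hh] hx; exists h => //.
  (* The remaining conjunct [h <= 1] holds because the generators are below [1]. *)
  by rewrite le_absval hx.1 hx.2 (gen_submonoid_le1 S1).
by move: hx; rewrite le_absval => /and3P[].
Qed.
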